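(* Let $r,s\ge0$ be integers with $r+s\le3$ and let $x,y$ be distinct vertices of $B_{r,s}=P_3^{\square r}\square Q_s$. Suppose that at least one of $x,y$ is not a corner and that $H=B_{r,s}-\{x,y\}$ is nonempty and is not an isometric subgraph of $B_{r,s}$. Then $H$ is a partial cube if and only if, up to an automorphism of $B_{r,s}$, the unordered pair $\{x,y\}$ is one of the following eleven pairs (a semicolon separates the first $r$ coordinates from the last $s$): in $B_{2,0}$: $\{(1,1),(0,0)\}$, $\{(0,1),(2,0)\}$, $\{(1,1),(1,0)\}$, $\{(1,0),(1,2)\}$; in $B_{1,2}$: $\{(1;00),(0;01)\}$, $\{(1;00),(1;01)\}$; in $B_{2,1}$: $\{(0,1;0),(1,0;0)\}$, $\{(1,1;0),(1,1;1)\}$, $\{(0,1;0),(0,0;1)\}$, $\{(0,1;0),(0,1;1)\}$; in $B_{3,0}$: $\{(0,0,1),(0,1,0)\}$. Moreover, for each of these eleven pairs, the graph $H$ is not a daisy cube and is not pc-minor-minimal (that is, $H$ has a proper pc-minor that is not a daisy cube).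
   Context: Graphs are finite and simple; partial cubes are connected by convention. $P_3$ is the path on three vertices, $Q_s$ the hypercube on $\{0,1\}^s$, $\square$ the Cartesian product, $G^{\square0}=Q_0=K_1$. Coordinate model: $V(B_{r,s})=\{0,1,2\}^r\times\{0,1\}^s$, two vertices being adjacent iff they differ in exactly one coordinate and there by exactly $1$. A corner is a vertex whose first $r$ coordinates all lie in $\{0,2\}$. $B_{r,s}-\{x,y\}$ is the subgraph induced by the remaining vertices. A subgraph $H$ of $G$ is isometric if $d_H(u,v)=d_G(u,v)$ for all $u,v\in V(H)$. A partial cube is a graph isomorphic to an isometric subgraph of a hypercube. A daisy cube is a graph isomorphic to the induced subgraph $Q_n[D]$ for some $n\ge0$ and nonempty down-set $D\subseteq\{0,1\}^n$ (coordinatewise order). In a partial cube, $ab\,\Theta\,uv$ iff $d(a,u)+d(b,v)\ne d(a,v)+d(b,u)$; this is an equivalence relation on edges, and each class ($\Theta$-class) determines two complementary halfspaces $\{z:d(a,z)<d(b,z)\}$, $\{z:d(b,z)<d(a,z)\}$. A restriction of a partial cube is the subgraph induced by a halfspace of a $\Theta$-class; a contraction is obtained by contracting all edges of one $\Theta$-class (suppressing loops and parallel edges). A pc-minor is any graph obtained by a finite sequence of restrictions and contractions; it is proper if not isomorphic to the original graph. *)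

(* Defs.v *)
From mathcomp Require Import all_boot.

Set Implicit Arguments.
Unset Strict Implicit.
Unset Printing Implicit Defensive.

Record sgraph := SGraph {
  vertex :> finType;
  adj : rel vertex;
  adj_sym : symmetric adj;
  adj_irr : irreflexive adj
}.

Definition is_iso (G H : sgraph) (f : G -> H) : Prop :=
  bijective f /\ forall u v : G, adj (f u) (f v) = adj u v.

Definition isomorphic (G H : sgraph) : Prop := exists f : G -> H, is_iso f.

Section Induced.
Variables (G : sgraph) (A : {set G}).

Definition induced_rel : rel {v : G | v \in A} :=
  fun u v => adj (val u) (val v).

Fact induced_sym : symmetric induced_rel.
Proof. by move=> u v; rewrite /induced_rel adj_sym. Qed.

Fact induced_irr : irreflexive induced_rel.
Proof. by move=> u; rewrite /induced_rel adj_irr. Qed.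

Definition induced : sgraph := SGraph induced_sym induced_irr.
End Induced.

Section Distance.
Variable G : sgraph.

Definition walk (n : nat) (u v : G) : bool :=
  [exists p : n.-tuple G, path (@adj G) u p && (last u p == v)].

(* A shortest walk visits each vertex at most once, so only lengths below #|G|
   have to be searched; None is the infinite distance. *)
Definition dist (u v : G) : option nat :=
  let n := find (fun n => walk n u v) (iota 0 #|G|) in
  if n < #|G| then Some n else None.

(* The distance as a natural number, meaningful in connected graphs only. *)
Definition fdist (u v : G) : nat := odflt 0 (dist u v).
End Distance.

(* Adjacency is distance one, so an isometric subgraph is always induced and
   is given by its vertex set. *)
Definition isometric (G : sgraph) (A : {set G}) : Prop :=
  forall u v : {x : G | x \in A},
    dist (u : induced A) (v : induced A) = dist (val u) (val v).

Section Hypercube.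
Variable n : nat.

Definition cube_rel : rel (n.-tuple bool) :=
  fun u v => #|[set i | tnth u i != tnth v i]| == 1.

Fact cube_sym : symmetric cube_rel.
Proof.
by move=> u v; congr (_ == 1); apply: eq_card => i; rewrite !inE eq_sym.
Qed.

Fact cube_irr : irreflexive cube_rel.
Proof. by move=> u; rewrite /cube_rel eq_card0 // => i; rewrite !inE eqxx. Qed.

Definition hypercube : sgraph := SGraph cube_sym cube_irr.
End Hypercube.

(* Partial cubes are connected, hence nonempty. *)
Definition partial_cube (G : sgraph) : Prop :=
  exists (n : nat) (A : {set hypercube n}),
    [/\ A != set0, isometric A & isomorphic G (induced A)].

Definition down_set (n : nat) (D : {set hypercube n}) : Prop :=
  forall u v : n.-tuple bool,
    v \in D -> (forall i, tnth u i <= tnth v i) -> u \in D.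

Definition daisy_cube (G : sgraph) : Prop :=
  exists (n : nat) (D : {set hypercube n}),
    [/\ D != set0, down_set D & isomorphic G (induced D)].

Section Theta.
Variables (G : sgraph) (a b : G).

Definition Theta (u v : G) : bool :=
  fdist a u + fdist b v != fdist a v + fdist b u.

(* The complementary halfspace is obtained by exchanging a and b. *)
Definition halfspace : {set G} := [set z | fdist a z < fdist b z].

Definition restriction : sgraph := induced halfspace.

Definition class_rel : rel G := fun u v => adj u v && Theta u v.

(* The vertices of the contraction are the connected components of the
   spanning subgraph whose edges are those of the Theta-class of ab. *)
Definition class_components : {set {set G}} :=
  [set [set v | connect class_rel u v] | u : G].

Definition contraction_rel : rel {C : {set G} | C \in class_components} :=
  fun C D => (C != D) &&
    [exists u, exists v, [&& u \in val C, v \in val D & adj u v]].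

Fact contraction_sym : symmetric contraction_rel.
Proof.
move=> C D; rewrite /contraction_rel eq_sym; congr (_ && _).
apply/existsP/existsP=> -[u /existsP[v /and3P[uC vD uv]]]; exists v;
  by apply/existsP; exists u; rewrite uC vD adj_sym.
Qed.

Fact contraction_irr : irreflexive contraction_rel.
Proof. by move=> C; rewrite /contraction_rel eqxx. Qed.

Definition contraction : sgraph := SGraph contraction_sym contraction_irr.
End Theta.

Inductive pc_minor (G : sgraph) : sgraph -> Prop :=
| pc_minor_refl : pc_minor G G
| pc_minor_restriction (M : sgraph) (a b : M) :
    pc_minor G M -> adj a b -> pc_minor G (restriction a b)
| pc_minor_contraction (M : sgraph) (a b : M) :
    pc_minor G M -> adj a b -> pc_minor G (contraction a b).

Definition proper_pc_minor (G M : sgraph) : Prop :=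
  pc_minor G M /\ ~ isomorphic M G.

Section B.
Variables r s : nat.

Notation B_vertex := (r.-tuple 'I_3 * s.-tuple bool)%type.

(* Distinct boolean coordinates automatically differ by exactly one. *)
Definition B_rel : rel B_vertex := fun u v =>
  (#|[set i | tnth u.1 i != tnth v.1 i]|
     + #|[set j | tnth u.2 j != tnth v.2 j]| == 1)
  && [forall i, (tnth u.1 i != tnth v.1 i) ==>
       ((tnth u.1 i == (tnth v.1 i).+1 :> nat)
        || (tnth v.1 i == (tnth u.1 i).+1 :> nat))].

Fact B_sym : symmetric B_rel.
Proof.
move=> u v; congr (_ && _).
  by congr (_ + _ == 1); apply: eq_card => i; rewrite !inE eq_sym.
by apply: eq_forallb => i; rewrite eq_sym orbC.
Qed.

Fact B_irr : irreflexive B_rel.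
Proof.
by move=> u; rewrite /B_rel !eq_card0 // => i; rewrite !inE eqxx.
Qed.

Definition B : sgraph := SGraph B_sym B_irr.

Definition corner (v : B) : Prop :=
  forall i : 'I_r, tnth v.1 i = 0 :> nat \/ tnth v.1 i = 2 :> nat.
End B.

Definition c0 : 'I_3 := @Ordinal 3 0 isT.
Definition c1 : 'I_3 := @Ordinal 3 1 isT.
Definition c2 : 'I_3 := @Ordinal 3 2 isT.

Definition exceptional_pairs (r s : nat) : seq {set B r s} :=
  match r, s return seq {set B r s} with
  | 2, 0 =>
    [:: [set ([tuple c1; c1], [tuple]); ([tuple c0; c0], [tuple])];
        [set ([tuple c0; c1], [tuple]); ([tuple c2; c0], [tuple])];
        [set ([tuple c1; c1], [tuple]); ([tuple c1; c0], [tuple])];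
        [set ([tuple c1; c0], [tuple]); ([tuple c1; c2], [tuple])]]
  | 1, 2 =>
    [:: [set ([tuple c1], [tuple false; false]);
             ([tuple c0], [tuple false; true])];
        [set ([tuple c1], [tuple false; false]);
             ([tuple c1], [tuple false; true])]]
  | 2, 1 =>
    [:: [set ([tuple c0; c1], [tuple false]); ([tuple c1; c0], [tuple false])];
        [set ([tuple c1; c1], [tuple false]); ([tuple c1; c1], [tuple true])];
        [set ([tuple c0; c1], [tuple false]); ([tuple c0; c0], [tuple true])];
        [set ([tuple c0; c1], [tuple false]); ([tuple c0; c1], [tuple true])]]
  | 3, 0 =>
    [:: [set ([tuple c0; c0; c1], [tuple]); ([tuple c0; c1; c0], [tuple])]]
  | _, _ => [::]
  end.

(* Main.v *)
Require Import Defs.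
From mathcomp Require Import all_boot all_fingroup.
From mathcomp Require Import zify.

(** The graphs have at most 25 vertices, so the theorem is a finite
    verification; the lemmas below make it small and reduce it to conditions
    that can be evaluated.

    Symmetry. Two ordered pairs of vertices are related by permuting and
    reversing the axes as soon as they have the same multiset of columns, where
    a column is the pair of values on one axis, taken up to reversal
    ([pair_type_automorphism]). This leaves at most 35 types of pairs for
    given [r] and [s], and one representative of each type is examined.

    Distances. A function is the distance from a vertex as soon as it satisfies
    a few local conditions ([dist_local]). A table found by breadth-first search
    is therefore certified by testing these conditions on its values.

    Partial cubes. A graph is a partial cube iff its vertices can be labelled by
    bit vectors whose Hamming distance is the graph distance
    ([partial_cubeP]); for the eleven pairs the labelling takes one bit for each
    Theta-class, the side of its cut. Conversely, in a partial cube an edge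
    that crosses the cut of another edge determines the same cut
    ([halfspace_crossing]). In the remaining cases [H] is disconnected or
    violates this. The typical reason is as follows. Let [x] lie between [x']
    and [x''] on some path axis, and let [z], [z'], [z''] be their neighbours in a
    transverse direction. If only [x] is missing from a subgrid made of these
    six vertices and their translates along a third axis, then going around [x]
    through squares shows that the edges [x' z'] and [x'' z''] would have to
    determine the same cut, and then [x'] and [x''] would be as far apart as
    [z'] and [z'']; but the latter are at distance 2, while the former have lost
    their common neighbour and are at distance 4.

    Daisy cubes. A daisy cube has an origin [o] such that every vertex [u] has
    at least [d(o,u)] neighbours closer to [o] ([daisy_cube_origin]). For each
    of the eleven pairs this fails in [H], and it already fails in some
    halfspace of [H], which is a proper minor. *)

Set Implicit Arguments.
Unset Strict Implicit.
Unset Printing Implicit Defensive.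

(** * Distances and isomorphisms *)

(** Recognises a distance function without exhibiting shortest walks: the
    Lipschitz bound makes every walk to [u] at least [d u] long, and following
    decreasing neighbours back to [o] gives a walk of exactly that length,
    simple because [d] is strictly monotone along it. *)
Lemma dist_local (G : sgraph) (o : G) (d : G -> nat) :
    d o = 0 ->
    (forall u v : G, adj u v -> d v <= (d u).+1) ->
    (forall u : G, u != o -> exists2 v : G, adj u v & d u = (d v).+1) ->
  forall u, dist o u = Some (d u).
Proof.
move=> d0 dlip dstep u.
have [p [op pu dp]] : exists p,
    [/\ path (@adj G) o p, last o p = u & [seq d x | x <- p] = iota 1 (d u)].
  move: {2}(d u) (erefl (d u)) => k; elim: k u => [|k IH] u du.
    exists [::]; rewrite du; split=> //=; apply/eqP.
    by case: eqVneq => // /[!(eq_sym o)] /dstep[v _]; rewrite du.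
  have /dstep[v uv dv] : u != o by apply/eqP => uo; rewrite uo d0 in du.
  have [p [op pv dp]] := IH v (etrans (esym (congr1 predn dv)) (congr1 predn du)).
  exists (rcons p u); split; rewrite ?last_rcons ?rcons_path ?op ?pv 1?adj_sym //.
  by rewrite map_rcons dp dv -(addn1 (d v)) iotaD cats1 [1 + _]addnC.
have short n : walk n o u -> d u <= n.
  case/existsP=> -[q /= /eqP<-] /andP[oq /eqP<-].
  elim/last_ind: q oq => [|q x IH] /=; first by rewrite d0.
  rewrite rcons_path last_rcons size_rcons => /andP[/IH le_q /dlip le_x].
  exact: leq_trans le_x _.
have walk_u : walk (d u) o u.
  have sp : size p == d u by rewrite -(size_map d) dp size_iota.
  by apply/existsP; exists (Tuple sp); rewrite /= op pu eqxx.
have lt_u : d u < #|G|.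
  have Up : uniq (o :: p).
    apply: (@map_uniq _ _ d); rewrite map_cons dp d0.
    exact: (iota_uniq 0 (d u).+1).
  rewrite -(size_iota 1 (d u)) -dp size_map -[_.+1]/(size (o :: p)).
  by rewrite -(card_uniqP Up) max_card.
suff find_u : find (fun n => walk n o u) (iota 0 #|G|) = d u.
  by rewrite /dist find_u lt_u.
apply/eqP; rewrite eqn_leq; apply/andP; split.
  rewrite leqNgt; apply/negP => /(before_find 0).
  by rewrite nth_iota // walk_u.
rewrite leqNgt; apply/negP => lt_find.
have : has (fun n => walk n o u) (iota 0 #|G|).
  by apply/hasP; exists (d u); rewrite ?mem_iota.
move/(nth_find 0); rewrite nth_iota ?add0n ?(ltn_trans lt_find) // => /short.
by rewrite leqNgt lt_find.
Qed.

Lemma dist_walk (G : sgraph) (u v : G) n : dist u v = Some n -> walk n u v.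
Proof.
rewrite /dist; case: ifP => // lt_find [<-].
have := lt_find; rewrite -{2}(size_iota 0 #|G|) -has_find => /(nth_find 0).
by rewrite nth_iota.
Qed.

Lemma fdistxx (G : sgraph) (u : G) : fdist u u = 0.
Proof.
rewrite /fdist /dist; case: #|G| (fintype0 u) => [|k _]; first by move=> /(_ erefl).
have -> // : find (fun n => walk n u u) (iota 0 k.+1) = 0.
have -> // : find (fun n => walk n u u) (0 :: iota 1 k) = 0.
by rewrite /= ifT //; apply/existsP; exists [tuple]; rewrite /= eqxx.
Qed.

Lemma dist_eq (G : sgraph) (u v : G) : dist u v = Some 0 -> u = v.
Proof. by move/dist_walk/existsP=> [p]; rewrite tuple0 /= => /eqP. Qed.

Lemma adj_dist (G : sgraph) (u v : G) : adj u v = (dist u v == Some 1).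
Proof.
apply/idP/eqP => [uv | /dist_walk/existsP[p]]; last first.
  by case/tupleP: p => x p; rewrite tuple0 /= andbT => /andP[+ /eqP<-].
have neq_uv : u != v by apply/eqP => uv'; rewrite uv' adj_irr in uv.
have walk0 : walk 0 u v = false.
  by apply/existsP => -[p]; rewrite tuple0 /= (negPf neq_uv).
have walk1 : walk 1 u v by apply/existsP; exists [tuple v]; rewrite /= uv eqxx.
have : 1 < #|G| by rewrite (cardD1 u) (cardD1 v) !inE eq_sym neq_uv.
by rewrite /dist; case: #|G| => [|[|k]] //= _; rewrite walk0 walk1.
Qed.

Lemma iso_dist (G H : sgraph) (f : G -> H) :
  is_iso f -> forall u v, dist (f u) (f v) = dist u v.
Proof.
move=> [[g fK gK] fadj] u v.
have walk_f n : walk n (f u) (f v) = walk n u v.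
  apply/existsP/existsP=> -[p /andP[up /eqP pv]].
    exists (map_tuple g p); apply/andP; split.
      rewrite /= -[u]fK path_map; apply: sub_path up => x y.
      by rewrite /= -fadj !gK.
    by rewrite /= -[u]fK last_map pv fK.
  exists (map_tuple f p); rewrite /= path_map last_map pv eqxx andbT.
  by apply: sub_path up => x y; rewrite /= fadj.
rewrite /dist (bij_eq_card (Bijective fK gK)); congr (if _ < _ then Some _ else _).
  exact: eq_find.
exact: eq_find.
Qed.

(** Restrictions are always proper minors: [b] is lost, so the number of
    vertices drops. *)
Lemma restriction_not_isomorphic (G : sgraph) (a b : G) :
  ~ isomorphic (restriction a b) G.
Proof.
move=> [f [/bij_eq_card + _]]; rewrite card_sig => eq_card.
have : halfspace a b \proper [set: G].
  apply/properP; split; first exact: subsetT.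
  by exists b; rewrite // inE fdistxx.
by move/proper_card; rewrite cardsT -eq_card ltnn.
Qed.

(** * Hamming distance and partial cubes *)

Definition hamming n (u v : n.-tuple bool) : nat :=
  \sum_(i < n) (tnth u i != tnth v i).

Definition flip n (i : 'I_n) (u : n.-tuple bool) : n.-tuple bool :=
  [tuple tnth u j (+) (j == i) | j < n].

Lemma hamming_flip n (i : 'I_n) (u v : n.-tuple bool) :
  hamming u v + (tnth u i == tnth v i) =
  hamming u (flip i v) + (tnth u i != tnth v i).
Proof.
rewrite /hamming [in LHS](bigD1 i) // [in RHS](bigD1 i) //= tnth_mktuple eqxx addbT.
under [in RHS]eq_bigr => j /negPf ji do rewrite tnth_mktuple ji addbF.
by rewrite addnAC [in RHS]addnAC; case: (tnth u i); case: (tnth v i).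
Qed.

Lemma cube_relP n (u v : n.-tuple bool) :
  reflect (exists i, v = flip i u) (cube_rel u v).
Proof.
apply: (iffP cards1P) => -[i uv]; exists i.
  apply: eq_from_tnth => j; rewrite tnth_mktuple.
  have /setP/(_ j) := uv; rewrite !inE => <-.
  by case: (tnth u j); case: (tnth v j).
apply/setP=> j; rewrite !inE uv tnth_mktuple.
by case: (tnth u j); case: (j == i).
Qed.

Lemma hamming_eq0 n (u v : n.-tuple bool) : (hamming u v == 0) = (u == v).
Proof.
rewrite sum_nat_eq0; apply/forallP/eqP => [uv | -> i]; last by rewrite eqxx.
by apply: eq_from_tnth => i; have := uv i; rewrite /= eqb0 negbK => /eqP.
Qed.

Lemma hammingxx n (u : n.-tuple bool) : hamming u u = 0.
Proof. by apply/eqP; rewrite hamming_eq0. Qed.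

Lemma hamming_cube_rel n (u v : n.-tuple bool) :
  cube_rel u v = (hamming u v == 1).
Proof. by rewrite /cube_rel /hamming -sum1dep_card big_mkcond. Qed.

Lemma hamming_step n (o u : n.-tuple bool) : o != u ->
  exists2 i, tnth o i != tnth u i & hamming o u = (hamming o (flip i u)).+1.
Proof.
rewrite -hamming_eq0 sum_nat_eq0 => /forallPn[i] /=.
rewrite eqb0 negbK => oi; exists i => //.
by have := hamming_flip i o u; rewrite (negPf oi) addn0 addn1.
Qed.

Lemma hamming_adj n (o u v : n.-tuple bool) :
  cube_rel u v -> hamming o v <= (hamming o u).+1.
Proof.
move=> /cube_relP[i ->]; rewrite -addn1.
apply: leq_trans (leq_addr (tnth o i != tnth u i) _) _.
by rewrite -hamming_flip leq_add2l leq_b1.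
Qed.

Lemma dist_hypercube n (u v : hypercube n) : dist u v = Some (hamming u v).
Proof.
apply: dist_local; [exact: hammingxx | exact: hamming_adj |].
move=> {}v; rewrite eq_sym => /hamming_step[i _ ->]; exists (flip i v) => //.
by apply/cube_relP; exists i.
Qed.

(** Replaces the isometric subgraph of the definition by a labelling of the
    vertices, which is what can be computed with: a labelling that turns
    distances into Hamming distances is automatically injective and preserves
    adjacency in both directions, as equality and adjacency are distances zero
    and one. *)
Lemma partial_cubeP (G : sgraph) :
  partial_cube G <->
  inhabited G /\ exists n (g : G -> n.-tuple bool),
    forall u v, dist u v = Some (hamming (g u) (g v)).
Proof.
split=> [[n [A [/set0Pn[z zA] isoA [h hiso]]]] | [[z] [n [g gdist]]]].
  have [k _ _] := hiso.1; split; first by exists; apply: k (exist _ z zA).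
  exists n, (fun u => val (h u)) => u v.
  by rewrite -(iso_dist hiso) isoA dist_hypercube.
pose A : {set hypercube n} := [set g u | u : G]; exists n, A.
have gA u : g u \in A by apply: imset_f.
have ginj : injective g.
  by move=> u v guv; apply: dist_eq; rewrite gdist guv hammingxx.
pose h u : induced A := exist _ (g u) (gA u).
have hiso : is_iso h.
  split; last first.
    move=> u v; rewrite /= /induced_rel /= hamming_cube_rel.
    by rewrite adj_dist gdist -(inj_eq (@Some_inj _)).
  apply: inj_card_bij; first by move=> u v [/ginj].
  by rewrite card_sig card_imset.
split; [by apply/set0Pn; exists (g z) | | by exists h].
move=> [u uA] [v vA]; case/imsetP: (uA) => a _ ua; case/imsetP: (vA) => b _ vb.
have -> : exist _ u uA = h a by apply: val_inj.
have -> : exist _ v vA = h b by apply: val_inj.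
by rewrite (iso_dist hiso) gdist dist_hypercube.
Qed.

(** * Necessary conditions for partial cubes and daisy cubes *)

Lemma partial_cube_connected (G : sgraph) :
  partial_cube G -> forall u v : G, connect (@adj G) u v.
Proof.
move=> /partial_cubeP[_ [n [g gdist]]] u v.
have /dist_walk/existsP[p /andP[up /eqP pv]] := gdist u v.
by apply/connectP; exists p.
Qed.

(** The two ends of an edge differ in one coordinate [i] only, so which of
    them is closer to [z] is decided by the [i]-th bit of [z]. *)
Lemma halfspace_coordinate (G : sgraph) n (g : G -> n.-tuple bool) (a b : G) :
    (forall u v, dist u v = Some (hamming (g u) (g v))) -> adj a b ->
  exists2 i, g b = flip i (g a) &
    forall z, (z \in halfspace a b) = (tnth (g a) i == tnth (g z) i).
Proof.
move=> gdist; rewrite adj_dist gdist (inj_eq (@Some_inj _)).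
rewrite -hamming_cube_rel => /cube_relP[i gb]; exists i => // z.
have hammingC u v : hamming u v = hamming v u :> nat.
  by apply: eq_bigr => j _; rewrite eq_sym.
rewrite inE /fdist !gdist /= ![hamming _ (g z)]hammingC gb eq_sym.
have := hamming_flip i (g z) (g a).
case: eqP => _ /=; rewrite addn0 addn1; first by move<-; rewrite leqnn.
by move=> ->; rewrite ltnNge leqnSn.
Qed.

(** The obstruction used against partial cubes: an edge [uw] that crosses the
    cut of [ab] flips the same coordinate as [ab], and that coordinate
    determines both halfspaces. This is a form of the transitivity of the
    relation Theta. *)
Lemma halfspace_crossing (G : sgraph) (a b u w : G) :
    partial_cube G -> adj a b -> adj u w ->
    u \in halfspace a b -> w \notin halfspace a b ->
  halfspace u w = halfspace a b.
Proof.
move=> /partial_cubeP[_ [n [g gdist]]] ab uw.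
have [i _ Hi] := halfspace_coordinate gdist ab.
have [j gw Hj] := halfspace_coordinate gdist uw.
rewrite !Hi => /eqP au aw; apply/setP => z; rewrite Hi Hj.
suff -> : j = i by rewrite au.
apply/eqP; apply: contraNT aw => ji.
by rewrite au gw tnth_mktuple [i == j]eq_sym (negPf ji) addbF.
Qed.

(** The obstruction used against daisy cubes. Take for [o] the vertex labelled
    by the zero vector: in a down-set every 1 of a label can be cleared, so the
    distance to [o] is the weight of the label, and a vertex of weight [k] has
    [k] neighbours closer to [o]. *)
Lemma daisy_cube_origin (G : sgraph) : daisy_cube G ->
  exists o : G, forall u : G,
    fdist o u <= #|[set v | adj u v & fdist o v < fdist o u]|.
Proof.
move=> [n [D [/set0Pn[x xD] downD [h [[k hK kK] hadj]]]]].
pose w u : n.-tuple bool := val (h u).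
pose zero : n.-tuple bool := [tuple false | i < n].
have zeroD : zero \in D.
  by apply: downD xD _ => i; rewrite tnth_mktuple.
pose o := k (exist _ zero zeroD).
have wo : w o = zero by rewrite /w kK.
have wadj u v : adj u v = cube_rel (w u) (w v) by rewrite -hadj.
pose low u i := k (insubd (h u) (flip i (w u))).
have lowE u i : tnth (w u) i -> w (low u i) = flip i (w u).
  move=> ui; rewrite /w kK insubdK //; apply: downD (valP (h u)) _ => j.
  by rewrite tnth_mktuple; case: eqP => [->|_]; rewrite ?addbF // -/(w u) ui.
have low_adj u i : tnth (w u) i -> adj u (low u i).
  by move=> ui; rewrite wadj lowE //; apply/cube_relP; exists i.
have dist_o u : dist o u = Some (hamming zero (w u)).
  apply: (dist_local (d := fun u => hamming zero (w u))).
  - by rewrite wo hammingxx.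
  - by move=> {}u v; rewrite wadj => /hamming_adj.
  move=> {}u neq_uo; have /hamming_step[i] : zero != w u.
    apply: contraNneq neq_uo => zu; apply/eqP/(can_inj hK)/val_inj.
    by rewrite -/(w u) -/(w o) wo.
  rewrite tnth_mktuple; case: (boolP (tnth _ i)) => // ui _ eq_h.
  by exists (low u i); rewrite ?low_adj // lowE.
have fdist_o u : fdist o u = hamming zero (w u) by rewrite /fdist dist_o.
exists o => u; rewrite [leqLHS]fdist_o.
have suppE : hamming zero (w u) = #|[set i | tnth (w u) i]|.
  rewrite -sum1dep_card big_mkcond; apply: eq_bigr => i _.
  by rewrite tnth_mktuple; case: (tnth _ i).
rewrite [leqLHS]suppE -(card_in_imset (f := low u)).
  apply/subset_leq_card/subsetP => v /imsetP[i]; rewrite inE => ui ->.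
  rewrite inE low_adj // !fdist_o lowE //.
  have := hamming_flip i zero (w u); rewrite tnth_mktuple ui /= addn0 addn1.
  by move=> ->.
move=> i j; rewrite !inE => ui uj /(congr1 w); rewrite !lowE // => eq_flip.
have := congr1 (fun t => tnth t i) eq_flip; rewrite !tnth_mktuple eqxx ui.
by case: eqP.
Qed.

(** * Evaluable conditions on lists of points *)

Local Notation point := (seq nat).

Fixpoint manhattan (u v : point) : nat :=
  match u, v with
  | a :: u', b :: v' => (a - b) + (b - a) + manhattan u' v'
  | _, _ => 0
  end.

Definition near u v := manhattan u v == 1.

Definition edges (L : seq point) : seq (point * point) :=
  [seq (u, v) | u <- L, v <- [seq v <- L | near u v]].

Fixpoint lookup A (a : A) (t : seq (point * A)) (u : point) : A :=
  if t is (v, b) :: t' then if v == u then b else lookup a t' u else a.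

(** Breadth-first search: [front] is the layer at distance [k], and [rest] the
    points that have not been reached yet; [fuel] bounds the number of layers. *)
Fixpoint layers (fuel k : nat) (front rest : seq point) : seq (point * nat) :=
  [seq (u, k) | u <- front] ++
  if fuel is fuel'.+1 then
    let next := [seq u <- rest | has (near u) front] in
    layers fuel' k.+1 next [seq u <- rest | u \notin next]
  else [::].

Definition reach (L : seq point) (o : point) : seq (point * nat) :=
  layers (size L) 0 [:: o] [seq u <- L | u != o].

(** The table stands outside the [fun] so that it is computed once and shared
    by all lookups. *)
Definition bfs (L : seq point) : point -> point -> nat :=
  let table := [seq (o, reach L o) | o <- L] in
  fun o u => lookup 0 (lookup [::] table o) u.

(** The hypotheses of [dist_local] for all starting points. The tables computed
    by [bfs] are trusted only after passing this test. *)
Definition is_metric (L : seq point) (d : point -> point -> nat) : bool :=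
  all (fun u =>
    let N := [seq v <- L | near u v] in
    all (fun o =>
      (if u == o then d o u == 0 else has (fun v => d o u == (d o v).+1) N) &&
      all (fun v => d o v <= (d o u).+1) N) L) L.

Definition cut (d : point -> point -> nat) (e : point * point) (u : point) :=
  d e.1 u < d e.2 u.

(** One edge for each class of the relation Theta: an edge is dropped when it
    crosses a cut that has already been chosen. *)
Definition cut_representatives d (es : seq (point * point)) :=
  foldr (fun e fs =>
    if has (fun f => cut d f e.1 != cut d f e.2) fs then fs else e :: fs)
    [::] es.

(** The labelling tested here is the canonical one: one bit for each chosen
    edge, telling the side of its cut. *)
Definition embeds (L : seq point) d (es : seq (point * point)) : bool :=
  let bits := [seq (u, [seq cut d e u | e <- es]) | u <- L] in
  all (fun p => all (fun q =>
    count (fun b => b.1 != b.2) (zip p.2 q.2) == d p.1 q.1) bits) bits.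

(** A violation of [halfspace_crossing]. *)
Definition cuts_disagree (L : seq point) d : bool :=
  let es := edges L in
  has (fun e => has (fun f =>
    [&& cut d e f.1, ~~ cut d e f.2 & has (fun u => cut d f u != cut d e u) L])
    es) es.

(** The reached set [C] is tested for being closed under adjacency, so that
    nothing has to be known about the search. *)
Definition disconnected (L : seq point) : bool :=
  has (fun o => let C := unzip1 (reach L o) in
    [&& o \in C, all (fun u => all (fun v => near u v ==> (v \in C)) L) C
      & ~~ all (mem C) L]) L.

(** A violation of [daisy_cube_origin] at every candidate origin. *)
Definition no_daisy_origin (L : seq point) d : bool :=
  all (fun o => has (fun u =>
    count (fun v => near u v && (d o v < d o u)) L < d o u) L) L.

Definition has_nondaisy_halfspace (L : seq point) d : bool :=
  has (fun e =>
    let M := [seq u <- L | cut d e u] in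
    let dM := bfs M in is_metric M dM && no_daisy_origin M dM) (edges L).

(** * Graphs coded by lists of points *)

(** Finite types do not compute well inside the kernel, because their
    enumerations are locked; a coding moves a graph to an explicit list of
    points in which adjacency is Manhattan distance one. *)
Record coding (G : sgraph) (c : G -> point) (L : seq point) : Prop := Coding {
  coding_inj : injective c;
  coding_mem : forall t, t \in L <-> exists u, c u = t;
  coding_adj : forall u v, adj u v = near (c u) (c v)
}.

Section Coding.
Variables (G : sgraph) (c : G -> point) (L : seq point).
Hypothesis cL : coding c L.

Lemma coded u : c u \in L.
Proof. by apply/(coding_mem cL); exists u. Qed.

Lemma coding_induced (A : {set G}) (p : pred point) :
    (forall u, (u \in A) = p (c u)) ->
  coding (fun u : induced A => c (val u)) [seq t <- L | p t].
Proof.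
move=> Ap; split=> [u v /(coding_inj cL)/val_inj // | t | u v].
  rewrite mem_filter; split=> [/andP[pt /(coding_mem cL)[u ut]] | [u <-]].
    by have uA : u \in A; rewrite ?Ap ?ut //; exists (exist _ u uA).
  by rewrite coded -Ap (valP u).
exact: (coding_adj cL).
Qed.

(** Changing the coding by an automorphism moves a pair of vertices to any
    other pair of its orbit, which spares transporting the properties of the
    graphs themselves. *)
Lemma coding_iso (H : sgraph) (f : H -> G) :
  is_iso f -> coding (fun u => c (f u)) L.
Proof.
move=> [[g fK gK] fadj]; split=> [| t | u v].
- exact: inj_comp (coding_inj cL) (can_inj fK).
- split=> [/(coding_mem cL)[u <-] | [u <-]]; last exact: coded.
  by exists (g u); rewrite gK.
by rewrite -fadj (coding_adj cL).
Qed.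

Lemma coding_edges (P : point * point -> bool) :
  has P (edges L) -> exists a b, adj a b /\ P (c a, c b).
Proof.
move=> /hasP[e /allpairsPdep[u [v [uL]]]]; rewrite mem_filter.
move=> /andP[uv vL] -> Puv; have [a au] := (coding_mem cL u).1 uL.
have [b bv] := (coding_mem cL v).1 vL.
by exists a, b; rewrite (coding_adj cL) au bv.
Qed.

Section Metric.
Variable d : point -> point -> nat.
Hypothesis dL : is_metric L d.

Lemma coding_dist u v : dist u v = Some (d (c u) (c v)).
Proof.
have dLx w x := allP (allP dL _ (coded w)) _ (coded x).
apply: (@dist_local _ u (fun x => d (c u) (c x))).
- by have := dLx u u; rewrite eqxx => /andP[/eqP].
- move=> w x wx; have /andP[_ /allP] := dLx w u; apply.
  by rewrite mem_filter -(coding_adj cL) wx coded.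
move=> w; rewrite -(inj_eq (coding_inj cL)) => /negPf wu.
have := dLx w u; rewrite wu => /andP[/hasP[t]]; rewrite mem_filter.
move=> /andP[wt /(coding_mem cL)[x xt]] /eqP dw _.
by exists x; rewrite ?(coding_adj cL) xt.
Qed.

Lemma coding_fdist u v : fdist u v = d (c u) (c v).
Proof. by rewrite /fdist coding_dist. Qed.

Lemma coding_halfspace a b u : (u \in halfspace a b) = cut d (c a, c b) (c u).
Proof. by rewrite inE !coding_fdist. Qed.

Lemma coding_partial_cube es : 0 < size L -> embeds L d es -> partial_cube G.
Proof.
move=> L_gt0 /allP emb; apply/partial_cubeP; split.
  case: L L_gt0 (coding_mem cL) => // t L' _ /(_ t)[+ _].
  by rewrite mem_head => /(_ isT)[].
exists (size es), (fun u => map_tuple (fun e => cut d e (c u)) (in_tuple es)).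
move=> u v; rewrite coding_dist; congr Some.
have bits_mem w : (c w, [seq cut d e (c w) | e <- es]) \in
    [seq (t, [seq cut d e t | e <- es]) | t <- L].
  by apply: map_f; apply: coded.
have /allP/(_ _ (bits_mem v))/eqP /= <- := emb _ (bits_mem u).
rewrite /hamming.
under eq_bigr do rewrite !tnth_map.
rewrite -(big_tuple _ _ (in_tuple es) xpredT
           (fun e => nat_of_bool (cut d e (c u) != cut d e (c v)))) /=.
elim: es {bits_mem emb} => [|e es IH]; first by rewrite big_nil.
by rewrite big_cons -IH.
Qed.

Lemma coding_cuts_disagree : cuts_disagree L d -> ~ partial_cube G.
Proof.
move=> /coding_edges[a [b [ab /coding_edges[u [w [uw /and3P[]]]]]]] /=.
rewrite -!coding_halfspace => ua wa /hasP[t /(coding_mem cL)[x <-]].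
rewrite -!coding_halfspace => /eqP neq pcG; apply: neq.
by rewrite (halfspace_crossing pcG ab uw ua wa).
Qed.

Lemma coding_not_daisy : no_daisy_origin L d -> ~ daisy_cube G.
Proof.
move=> /allP noL /daisy_cube_origin[o origin].
have /hasP[t /(coding_mem cL)[u <-]] := noL _ (coded o).
rewrite ltnNge => /negP; apply; rewrite -coding_fdist.
apply: leq_trans (origin u) _; rewrite cardE -(size_map c) -size_filter.
apply: uniq_leq_size; first by rewrite (map_inj_uniq (coding_inj cL)) enum_uniq.
move=> t' /mapP[v]; rewrite mem_enum inE !coding_fdist => /andP[uv lt_v] ->.
by rewrite mem_filter -(coding_adj cL) uv lt_v coded.
Qed.

End Metric.

Lemma coding_disconnected : disconnected L -> ~ partial_cube G.
Proof.
move=> /hasP[t /(coding_mem cL)[o <-]] /and3P[oC closedC].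
move=> /allPn[_ /(coding_mem cL)[u <-] /negP uC] pcG; apply: uC => /=.
have /connectP[p op ->] := partial_cube_connected pcG o u.
set C := unzip1 _ in oC closedC *.
elim: p (o) oC op => //= v p IH x xC /andP[xv]; apply: IH.
by have := allP (allP closedC _ xC) _ (coded v); rewrite -(coding_adj cL) xv.
Qed.

End Coding.

(** When the Manhattan distance passes the test both in the graph and after
    the removal, it is the distance in both. *)
Lemma coding_isometric (G : sgraph) (c : G -> point) L (A : {set G})
    (p : pred point) :
    coding c L -> (forall u, (u \in A) = p (c u)) ->
    is_metric L manhattan -> is_metric [seq t <- L | p t] manhattan ->
  isometric A.
Proof.
move=> cL Ap mL mA u v.
by rewrite (coding_dist cL mL) (coding_dist (coding_induced cL Ap) mA).
Qed.

Lemma coding_nondaisy_minor (G : sgraph) (c : G -> point) L d :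
    coding c L -> is_metric L d -> has_nondaisy_halfspace L d ->
  exists M, proper_pc_minor G M /\ ~ daisy_cube M.
Proof.
move=> cL dL /(coding_edges cL)[a [b [ab /andP[dM noM]]]].
exists (restriction a b); split.
  split; last exact: restriction_not_isomorphic.
  exact: (pc_minor_restriction (pc_minor_refl G)).
apply: (coding_not_daisy _ dM noM).
exact: (coding_induced cL) (coding_halfspace cL dL a b).
Qed.

(** * The coordinate model as a list of points *)

Fixpoint words n m : seq (seq nat) :=
  if n is n'.+1 then [seq a :: w | a <- iota 0 m, w <- words n' m]
  else [:: [::]].

Definition grid r s : seq point := [seq u ++ v | u <- words r 3, v <- words s 2].

Definition without r s (x y : point) : seq point :=
  [seq u <- grid r s | u \notin [:: x; y]].

Definition code r s (v : B r s) : point :=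
  [seq nat_of_ord i | i <- v.1] ++ [seq nat_of_bool b | b <- v.2].

Lemma mem_words n m w : (w \in words n m) = (size w == n) && all (gtn m) w.
Proof.
elim: n w => [|n IH] [|a w] //=.
  by apply/negbTE/allpairsP => -[? []].
apply/idP/idP => [/allpairsP[[b v] /= [+ + [-> ->]]] | /and3P[sw am wm]].
  by rewrite mem_iota IH eqSS => /= -> ->.
by apply/allpairsP; exists (a, w); split; rewrite //= ?mem_iota // IH -eqSS sw.
Qed.

Lemma wordsP (T : Type) (e : T -> nat) n m w :
    (forall a, a < m <-> exists x, e x = a) ->
  w \in words n m <-> exists x : n.-tuple T, map e x = w.
Proof.
move=> em; rewrite mem_words; split=> [/andP[/eqP <-] | [x <-]].
  elim: w => [|a w IH] /=; first by exists [tuple].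
  by case/andP=> /em[b <-] /IH[x xw]; exists (cons_tuple b x); rewrite /= xw.
rewrite size_map size_tuple eqxx all_map /=.
by elim: (tval x) => //= b s ->; rewrite andbT; apply/em; exists b.
Qed.

(** The tails [s] and [t] let the same lemma peel off first the path
    coordinates and then the hypercube coordinates of a code. *)
Lemma manhattan_cat (T : Type) (e : T -> nat) n (x y : n.-tuple T) s t :
  manhattan (map e x ++ s) (map e y ++ t) =
  \sum_(i < n) ((e (tnth x i) - e (tnth y i)) + (e (tnth y i) - e (tnth x i)))
    + manhattan s t.
Proof.
elim: n x y => [|n IH] x y; first by rewrite (tuple0 x) (tuple0 y) big_ord0.
case/tupleP: x => a x; case/tupleP: y => b y.
rewrite big_ord_recl !tnth0 /= IH addnA; congr (_ + _ + _).
by apply: eq_bigr => i _; rewrite !tnthS.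
Qed.

Lemma manhattan_code r s (u v : B r s) :
  manhattan (code u) (code v) =
  \sum_(i < r) ((tnth u.1 i - tnth v.1 i) + (tnth v.1 i - tnth u.1 i)) +
  \sum_(j < s) ((tnth u.2 j - tnth v.2 j) + (tnth v.2 j - tnth u.2 j)).
Proof.
rewrite manhattan_cat -[map _ v.2]cats0 -[map _ u.2]cats0 manhattan_cat.
by rewrite addn0.
Qed.

(** A coordinate that changes by two or more already makes the Manhattan
    distance exceed one, so distance one includes the bound on the step. *)
Lemma near_code r s (u v : B r s) : adj u v = near (code u) (code v).
Proof.
rewrite /near manhattan_code /= /B_rel.
have -> : #|[set j | tnth u.2 j != tnth v.2 j]| = \sum_(j < s)
    ((tnth u.2 j - tnth v.2 j) + (tnth v.2 j - tnth u.2 j)).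
  rewrite -sum1dep_card big_mkcond; apply: eq_bigr => j _.
  by case: (tnth u.2 j); case: (tnth v.2 j).
set a := fun i => (tnth u.1 i - tnth v.1 i) + (tnth v.1 i - tnth u.1 i).
have -> : #|[set i | tnth u.1 i != tnth v.1 i]| = \sum_(i < r) (a i != 0).
  rewrite -sum1dep_card big_mkcond; apply: eq_bigr => i _.
  by rewrite /a addn_eq0 !subn_eq0 -eqn_leq val_eqE; case: eqP.
under eq_forallb => i.
  have -> : (tnth u.1 i != tnth v.1 i) ==>
      ((tnth u.1 i == (tnth v.1 i).+1 :> nat)
       || (tnth v.1 i == (tnth u.1 i).+1 :> nat)) = (a i <= 1).
    by rewrite /a -val_eqE /=; lia.
  over.
have [/forallP a_le1 | /forallPn[i]] := boolP [forall i, a i <= 1].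
  rewrite andbT; congr (_ + _ == 1); apply: eq_bigr => i _.
  by have := a_le1 i; rewrite -/(a i); case: (a i) => [|[]].
rewrite -ltnNge andbF => a_gt1; rewrite gtn_eqF //.
by rewrite (bigD1 i) //= -/(a i) -addnA; apply: leq_trans a_gt1 (leq_addr _ _).
Qed.

Lemma coding_B r s : coding (@code r s) (grid r s).
Proof.
have ord3 a : a < 3 <-> exists i : 'I_3, nat_of_ord i = a.
  by split=> [a3 | [i <-] //]; exists (Ordinal a3).
have bool2 a : a < 2 <-> exists b : bool, nat_of_bool b = a.
  split=> [|[b <-]]; last by case: b.
  by case: a => [|[]] // _; [exists false | exists true].
split=> [[u1 u2] [v1 v2] | t |]; last exact: near_code.
  rewrite /code /= => /eqP; rewrite eqseq_cat ?size_map ?size_tuple //.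
  case/andP=> /eqP/(inj_map val_inj)/val_inj -> /eqP/inj_map H.
  by congr (_, _); apply/val_inj/H; case; case.
split=> [/allpairsP[[p q] /= [/(wordsP _ _ ord3)[x <-]]] | [[x y] <-]].
  by move=> /(wordsP _ _ bool2)[y <-] ->; exists (x, y).
apply/allpairsP; exists (map (@nat_of_ord 3) x, map nat_of_bool y) => /=.
by split=> //; [apply/(wordsP _ _ ord3); exists x
              | apply/(wordsP _ _ bool2); exists y].
Qed.

(** * Orbits of pairs of vertices *)

(** The [i]-th coordinates of two vertices form a column. Read in base [m] it
    is a number [k] below [m * m], and reversing the axis turns [k] into
    [m * m - 1 - k]; the smaller of the two is invariant. *)
Definition column_type m (p : nat * nat) : nat :=
  minn (m * p.1 + p.2) ((m * m).-1 - (m * p.1 + p.2)).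

(** Sorting forgets the order of the axes. *)
Definition columns m (u v : seq nat) : seq nat :=
  sort leq [seq column_type m p | p <- zip u v].

Definition pair_type r s (x y : B r s) : seq nat * seq nat :=
  (columns 3 [seq nat_of_ord i | i <- x.1] [seq nat_of_ord i | i <- y.1],
   columns 2 [seq nat_of_bool b | b <- x.2] [seq nat_of_bool b | b <- y.2]).

(** Two tuples with the same multiset of invariant column numbers have their
    columns matched by a permutation of the axes; matched columns then agree
    up to mirroring the axis. *)
Lemma columns_perm (T : Type) (e : T -> nat) (mirror : bool -> T -> T) m n
    (x y x' y' : n.-tuple T) :
    (forall a b a' b',
       column_type m (e a, e b) = column_type m (e a', e b') ->
       exists f, a' = mirror f a /\ b' = mirror f b) ->
    columns m (map e x) (map e y) = columns m (map e x') (map e y') ->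
  exists (p : 'S_n) (f : 'I_n -> bool), forall i,
    tnth x' i = mirror (f i) (tnth x (p i)) /\
    tnth y' i = mirror (f i) (tnth y (p i)).
Proof.
move=> mirrorP eq_cols.
pose ct (x y : n.-tuple T) : n.-tuple nat :=
  [tuple column_type m (e (tnth x i), e (tnth y i)) | i < n].
have ctE (u v : n.-tuple T) :
    [seq column_type m q | q <- zip (map e u) (map e v)] = ct u v.
  rewrite -[in LHS](map_tnth_enum u) -[in LHS](map_tnth_enum v).
  by rewrite -[map e _]map_comp -[map e (map _ _)]map_comp zip_map -[LHS]map_comp.
have : perm_eq (ct x' y') (ct x y).
  by rewrite -!ctE -(perm_sort leq) -/(columns m _ _) -eq_cols perm_sort.
case/tuple_permP=> p ct_p; exists p.
pose P i f := tnth x' i = mirror f (tnth x (p i)) /\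
  tnth y' i = mirror f (tnth y (p i)).
apply: (@fin_all_exists _ _ P) => i; apply: mirrorP.
have := congr1 (fun t => nth 0 t i) ct_p.
by rewrite -!tnth_nth !tnth_mktuple.
Qed.

Definition mirror3 (f : bool) (a : 'I_3) : 'I_3 := if f then rev_ord a else a.

Lemma column_type3 (a b a' b' : 'I_3) :
    column_type 3 (nat_of_ord a, nat_of_ord b) =
      column_type 3 (nat_of_ord a', nat_of_ord b') ->
  exists f, a' = mirror3 f a /\ b' = mirror3 f b.
Proof.
rewrite /column_type /= => eq_type.
have : (a' = a :> nat /\ b' = b :> nat) \/
       (a' = 2 - a :> nat /\ b' = 2 - b :> nat).
  by move: (ltn_ord a) (ltn_ord b) (ltn_ord a') (ltn_ord b'); lia.
case=> -[ea eb]; [exists false | exists true].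
  by split; apply: val_inj.
by split; apply: val_inj; rewrite /= ?ea ?eb; lia.
Qed.

Lemma column_type2 (a b a' b' : bool) :
    column_type 2 (nat_of_bool a, nat_of_bool b) =
      column_type 2 (nat_of_bool a', nat_of_bool b') ->
  exists f, a' = f (+) a /\ b' = f (+) b.
Proof. by exists (a (+) a'); case: a b a' b' H => [] [] [] []. Qed.

(** The automorphism is composed of a permutation of the axes and reversals of
    single axes, hence respects corners; this carries the hypothesis on corners
    from a pair to the representative of its type. *)
Lemma pair_type_automorphism r s (x y x' y' : B r s) :
    pair_type x y = pair_type x' y' ->
  exists phi : B r s -> B r s,
    [/\ is_iso phi, phi x = x', phi y = y' &
        forall v, corner (phi v) -> corner v].
Proof.
case=> /(columns_perm column_type3)[p [f pf]].
move=> /(columns_perm column_type2)[q [g qg]].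
pose phi (v : B r s) : B r s :=
  ([tuple mirror3 (f i) (tnth v.1 (p i)) | i < r],
   [tuple g j (+) tnth v.2 (q j) | j < s]).
have mirrorK h : involutive (mirror3 h).
  by case: h => //; apply: rev_ordK.
have phi_inj : injective phi.
  move=> [u1 u2] [v1 v2] eq_phi.
  have [eq1 eq2] := (congr1 fst eq_phi, congr1 snd eq_phi).
  congr (_, _); apply: eq_from_tnth => i.
    have := congr1 (fun t => tnth t (p^-1%g i)) eq1.
    by rewrite !tnth_mktuple permKV => /(inv_inj (mirrorK _)).
  have := congr1 (fun t => tnth t (q^-1%g i)) eq2.
  by rewrite !tnth_mktuple permKV => /addbI.
exists phi; split.
- split; first exact: injF_bij.
  move=> u v; rewrite !(coding_adj (coding_B r s)) /near.
  rewrite !manhattan_code; congr (_ + _ == 1).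
    rewrite [RHS](reindex_inj (@perm_inj _ p)); apply: eq_bigr => i _.
    rewrite !tnth_mktuple /mirror3; case: (f i) => //=.
    by case: (tnth u.1 _) (tnth v.1 _) => a a3 [b b3] /=; lia.
  rewrite [RHS](reindex_inj (@perm_inj _ q)); apply: eq_bigr => j _.
  rewrite !tnth_mktuple.
  by case: (g j); case: (tnth u.2 _); case: (tnth v.2 _).
- case: x' y' pf qg => x1 x2 y' pf qg; congr (_, _); apply: eq_from_tnth => i.
    by rewrite tnth_mktuple (pf i).1.
  by rewrite tnth_mktuple (qg i).1.
- case: y' pf qg => y1 y2 pf qg; congr (_, _); apply: eq_from_tnth => i.
    by rewrite tnth_mktuple (pf i).2.
  by rewrite tnth_mktuple (qg i).2.
move=> v cv i; have := cv (p^-1%g i); rewrite tnth_mktuple permKV.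
rewrite /mirror3; case: (f _) => //=.
by case: (tnth v.1 i) => [[|[|[|k]]] k3] //= _; [left | right].
Qed.

(** * The finite verification *)

(** The two elements of a set cannot be extracted by computation, so the
    exceptional pairs are needed as ordered pairs. *)
Definition exceptional_vertices (r s : nat) : seq (B r s * B r s) :=
  match r, s return seq (B r s * B r s) with
  | 2, 0 =>
    [:: (([tuple c1; c1], [tuple]), ([tuple c0; c0], [tuple]));
        (([tuple c0; c1], [tuple]), ([tuple c2; c0], [tuple]));
        (([tuple c1; c1], [tuple]), ([tuple c1; c0], [tuple]));
        (([tuple c1; c0], [tuple]), ([tuple c1; c2], [tuple]))]
  | 1, 2 =>
    [:: (([tuple c1], [tuple false; false]), ([tuple c0], [tuple false; true]));
        (([tuple c1], [tuple false; false]), ([tuple c1], [tuple false; true]))]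
  | 2, 1 =>
    [:: (([tuple c0; c1], [tuple false]), ([tuple c1; c0], [tuple false]));
        (([tuple c1; c1], [tuple false]), ([tuple c1; c1], [tuple true]));
        (([tuple c0; c1], [tuple false]), ([tuple c0; c0], [tuple true]));
        (([tuple c0; c1], [tuple false]), ([tuple c0; c1], [tuple true]))]
  | 3, 0 =>
    [:: (([tuple c0; c0; c1], [tuple]), ([tuple c0; c1; c0], [tuple]))]
  | _, _ => [::]
  end.

(** The invariant column numbers are the lower halves of [0..8] and [0..3],
    whence the bounds 5 and 2. *)
Definition types r s : seq (seq nat * seq nat) :=
  [seq (p, q) | p <- [seq p <- words r 5 | sorted leq p],
                q <- [seq q <- words s 2 | sorted leq q]].

(** The base-[m] digits of the column numbers, which give a pair of points of
    the prescribed type. *)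
Definition first_point (t : seq nat * seq nat) : point :=
  [seq k %/ 3 | k <- t.1] ++ [seq k %/ 2 | k <- t.2].
Definition second_point (t : seq nat * seq nat) : point :=
  [seq k %% 3 | k <- t.1] ++ [seq k %% 2 | k <- t.2].

(** The possible reasons why the equivalence holds for the pairs of type [t]:
    an excluded pair (equal vertices, two corners, isometric subgraph), an
    exceptional pair in one of its two orders, or a subgraph that is not a
    partial cube. The corner test sees that the first [r] coordinates avoid the
    middle value. *)
Definition classified r s t : bool :=
  let x := first_point t in
  let y := second_point t in
  let L := without r s x y in
  [|| x == y,
      all (fun a => a != 1) (take r x ++ take r y),
      has (fun p => (pair_type p.1 p.2 == t) || (pair_type p.2 p.1 == t))
        (exceptional_vertices r s),
      is_metric L manhattan,
      disconnected L |
      let d := bfs L in is_metric L d && cuts_disagree L d].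

Definition certified r s (p : B r s * B r s) : bool :=
  let L := without r s (code p.1) (code p.2) in
  let d := bfs L in
  [&& 0 < size L, is_metric L d,
      embeds L d (cut_representatives d (edges L)),
      no_daisy_origin L d & has_nondaisy_halfspace L d].

Definition verified r s : bool :=
  [&& is_metric (grid r s) manhattan, all (@classified r s) (types r s)
    & all (@certified r s) (exceptional_vertices r s)].

Definition small_dimensions : seq (nat * nat) :=
  [seq (r, s) | r <- iota 0 4, s <- iota 0 (4 - r)].

Lemma verified_small : all (fun p => verified p.1 p.2) small_dimensions.
Proof.
(* The evaluation is left to the conversion of the kernel because it is lazy:
   Boolean connectives and searches then stop as early as they can, whereas
   call-by-value would compute the distance tables of every disjunct. *)
exact_no_check (erefl true).
Qed.

Lemma verifiedP r s : r + s <= 3 -> verified r s.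
Proof.
move=> rs; apply: (allP verified_small (r, s)).
by case: r s rs => [|[|[|[|r]]]] [|[|[|[|s]]]].
Qed.

(** * The classification *)

Lemma exceptional_pairsE r s :
  exceptional_pairs r s = [seq [set p.1; p.2] | p <- exceptional_vertices r s].
Proof. by case: r s => [|[|[|[|r]]]] [|[|[|s]]]. Qed.

Lemma pair_type_mem r s (x y : B r s) : pair_type x y \in types r s.
Proof.
apply/allpairsP; exists (pair_type x y); rewrite -surjective_pairing.
split=> //; rewrite mem_filter sort_sorted ?mem_words ?size_sort ?size_map //=;
  try exact: leq_total.
all: rewrite size_zip !size_map !size_tuple minnn eqxx all_sort all_map /=.
all: by apply/allP => q _; rewrite /column_type /=; lia.
Qed.

(** A column number [k] in the lower half is its own invariant, and
    [k %/ m], [k %% m] are its digits. *)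
Lemma columns_word m n k w : w \in words n k -> sorted leq w ->
    (k.-1).*2 < m * m ->
  columns m [seq a %/ m | a <- w] [seq a %% m | a <- w] = w.
Proof.
rewrite mem_words => /andP[_ /allP wk] sw km.
rewrite /columns zip_map -map_comp map_id_in ?sorted_sort //.
  exact: leq_trans.
move=> a /wk /=; rewrite /column_type /= mulnC -divn_eq => ak.
by apply/minn_idPl; lia.
Qed.

Lemma pair_of_type r s t : t \in types r s ->
  exists x y : B r s,
    [/\ code x = first_point t, code y = second_point t & pair_type x y = t].
Proof.
case/allpairsP => -[p q] /= [].
rewrite !mem_filter => /andP[sp pw] /andP[sq qw] ->.
have word_map f n m k w : (forall a, a < m -> f a < k) ->
    w \in words n m -> map f w \in words n k.
  move=> fmk; rewrite !mem_words size_map => /andP[-> /allP wm].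
  by rewrite all_map; apply/allP => a /wm /fmk.
have gridP f g : (forall a, a < 5 -> f a < 3) -> (forall a, a < 2 -> g a < 2) ->
    exists x : B r s,
      map (@nat_of_ord 3) x.1 = map f p /\ map nat_of_bool x.2 = map g q.
  move=> f3 g2; have : map f p ++ map g q \in grid r s.
    apply/allpairsP; exists (map f p, map g q).
    by split=> //; [exact: word_map pw | exact: word_map qw].
  case/(coding_mem (coding_B r s)) => x /eqP; rewrite eqseq_cat.
    by case/andP=> /eqP ? /eqP ?; exists x.
  rewrite !size_map size_tuple.
  by move: pw; rewrite mem_words => /andP[/eqP->].
have [|| x [x1 x2]] := gridP (divn^~ 3) (divn^~ 2); try by move=> a; lia.
have [|| y [y1 y2]] := gridP (modn^~ 3) (modn^~ 2); try by move=> a; lia.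
exists x, y; rewrite /code /pair_type x1 x2 y1 y2.
by split=> //; rewrite (columns_word pw) // (columns_word qw).
Qed.

(** The automorphism [phi] is absorbed in the coding: the graph left by [x] and
    [y] gets the list of points left by their images. *)
Lemma coding_without r s (phi : B r s -> B r s) (x y a b : B r s) :
    is_iso phi -> [set phi x; phi y] = [set a; b] ->
  coding (fun u : induced (~: [set x; y]) => code (phi (val u)))
    (without r s (code a) (code b)).
Proof.
move=> phi_iso eq_set.
apply: (coding_induced (coding_iso (coding_B r s) phi_iso)) => u.
have [/bij_inj phi_inj _] := phi_iso.
rewrite !inE !(inj_eq (coding_inj (coding_B r s))).
rewrite -[in LHS](inj_eq phi_inj) -[X in _ || X](inj_eq phi_inj).
by rewrite -!in_set2 eq_set.
Qed.

Lemma corner_code r s (x y : B r s) :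
    all (fun a => a != 1) (take r (code x) ++ take r (code y)) ->
  corner x /\ corner y.
Proof.
have cornerP (v : B r s) : all (fun a => a != 1) (take r (code v)) -> corner v.
  rewrite take_size_cat ?size_map ?size_tuple // => /allP v1 i.
  have := v1 _ (map_f _ (mem_tnth i v.1)).
  by case: (tnth v.1 i) => [[|[|[|k]]] k3] //= _; [left | right].
by rewrite all_cat => /andP[/cornerP ? /cornerP].
Qed.

Theorem lemma22 (r s : nat) (hrs : r + s <= 3) :
  (forall x y : B r s,
     x <> y ->
     ~ (corner x /\ corner y) ->
     ~: [set x; y] != set0 ->
     ~ isometric (~: [set x; y]) ->
     (partial_cube (induced (~: [set x; y])) <->
      exists phi : B r s -> B r s,
        is_iso phi /\ [set phi x; phi y] \in exceptional_pairs r s))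
  /\
  (forall P : {set B r s},
     P \in exceptional_pairs r s ->
     ~ daisy_cube (induced (~: P)) /\
     (exists M : sgraph,
        proper_pc_minor (induced (~: P)) M /\ ~ daisy_cube M)).
Proof.
have /and3P[gridL /allP classify /allP exc] := verifiedP hrs.
rewrite exceptional_pairsE; split=> [x y neq_xy ncorner _ niso | P].
  split=> [pcH | [phi [phi_iso /mapP[p p_exc eq_p]]]]; last first.
    have /and5P[L_gt0 dL emb _ _] := exc p p_exc.
    exact: (coding_partial_cube (coding_without phi_iso eq_p) dL L_gt0 emb).
  have [x0 [y0 [x0E y0E type0]]] := pair_of_type (pair_type_mem x y).
  have [phi [phi_iso phix phiy phi_corner]] :=
    pair_type_automorphism (esym type0).
  have eq_set : [set phi x; phi y] = [set x0; y0] by rewrite phix phiy.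
  have cH := coding_without phi_iso eq_set.
  have := classify _ (pair_type_mem x y).
  rewrite /classified -x0E -y0E => /orP[/eqP | /orP[| /orP[| /orP[| /orP[|]]]]].
  - rewrite -phix -phiy => /(coding_inj (coding_B r s)) eq_phi.
    by case: neq_xy; apply: bij_inj phi_iso.1 _ _ eq_phi.
  - move=> /corner_code[cx cy]; case: ncorner.
    by split; apply: phi_corner; rewrite ?phix ?phiy.
  - case/hasP=> p p_exc; case/orP=> /eqP/esym/pair_type_automorphism;
      case=> psi [psi_iso psix psiy _];
      exists psi; split=> //; apply/mapP; exists p => //;
      by rewrite psix psiy // setUC.
  - move=> mL; case: niso.
    apply: (coding_isometric (coding_iso (coding_B r s) phi_iso) _ _ mL).
      move=> u; rewrite !inE !(inj_eq (coding_inj (coding_B r s))).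
      rewrite -phix -phiy.
      by rewrite !(inj_eq (bij_inj phi_iso.1)).
    exact: gridL.
  - by move=> /(coding_disconnected cH).
  by move=> /andP[mL /(coding_cuts_disagree cH mL)].
case/mapP=> p p_exc ->; have /and5P[_ dL _ ndaisy minor] := exc p p_exc.
have id_iso : is_iso (@id (B r s)) by split=> //; exists id.
have cH : coding _ _ := coding_without id_iso (erefl [set p.1; p.2]).
split; first exact: (coding_not_daisy cH dL ndaisy).
exact: (coding_nondaisy_minor cH dL minor).
Qed.
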